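(* Let $n\ge 2$, $1\le r<n$, $s=n-r$, let $X_1,\dots,X_n,Y$ be Banach spaces over $\mathbb{K}$, let $q_1,\dots,q_s$ be positive real numbers, and let $A\in\mathcal{L}(X_1,\dots,X_n;Y)$. Suppose that there exists $C>0$ such that for all $x_1\in X_1,\dots,x_r\in X_r$ the $s$-linear mapping $A_{x_1\cdots x_r}:X_{r+1}\times\cdots\times X_n\to Y$ defined by $A_{x_1\cdots x_r}(x_{r+1},\dots,x_n)=A(x_1,\dots,x_n)$ is absolutely $(1;q_1,\dots,q_s)$-summing and $$\|A_{x_1\cdots x_r}\|_{as(1;q_1,\dots,q_s)}\le C\|A\|\,\|x_1\|\cdots\|x_r\|.$$ Then $A$ is absolutely $(1;1,\dots,1,q_1,\dots,q_s)$-summing, where $1$ is repeated $r$ times after the semicolon (once for each of $X_1,\dots,X_r$) and $q_1,\dots,q_s$ correspond to $X_{r+1},\dots,X_n$ respectively.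
   Context: The scalar field $\mathbb{K}$ is either $\mathbb{R}$ or $\mathbb{C}$. $\mathcal{L}(X_1,\dots,X_n;Y)$ is the Banach space of continuous $n$-linear mappings from $X_1\times\cdots\times X_n$ into $Y$ with the sup norm. For a finite sequence $(x_j)_{j=1}^k$ in a Banach space $X$ and $q>0$, $\|(x_j)_{j=1}^k\|_{w,q}=\sup_{\varphi\in B_{X'}}\left(\sum_{j=1}^k|\varphi(x_j)|^q\right)^{1/q}$, where $B_{X'}$ is the closed unit ball of the dual $X'$. A continuous $n$-linear mapping $A:X_1\times\cdots\times X_n\to Y$ is absolutely $(p;q_1,\dots,q_n)$-summing if there is a constant $L\ge 0$ such that $$\left(\sum_{j=1}^k\|A(x_1^{(j)},\dots,x_n^{(j)})\|^p\right)^{1/p}\le L\prod_{i=1}^n\|(x_i^{(j)})_{j=1}^k\|_{w,q_i}$$ for every $k\in\mathbb{N}$ and all $x_i^{(1)},\dots,x_i^{(k)}\in X_i$, $i=1,\dots,n$. The infimum of such $L$ is denoted $\|A\|_{as(p;q_1,\dots,q_n)}$. *)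

(* Defs.v *)
From HB Require Import structures.
From mathcomp Require Import all_boot all_order all_algebra.
From mathcomp Require Import complex.
From mathcomp Require Import all_classical all_reals all_analysis.

Set Implicit Arguments.
Unset Strict Implicit.
Unset Printing Implicit Defensive.

Import Order.TTheory GRing.Theory Num.Theory.
Import numFieldNormedType.Exports.

Local Open Scope classical_set_scope.
Local Open Scope ring_scope.

Variant scalar_kind := RealScalars | ComplexScalars.

Definition scalar_field (R : realType) (k : scalar_kind) : numFieldType :=
  match k with
  | RealScalars => (R : numFieldType)
  | ComplexScalars => (R[i] : numFieldType)
  end.

(* Over [R[i]] the library's norm takes its values in [R[i]], as complex numbers
   with zero imaginary part; [real_part] brings such values back to [R]. *)
Definition real_part (R : realType) (k : scalar_kind) : scalar_field R k -> R :=
  match k with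
  | RealScalars => fun a : R => a
  | ComplexScalars => fun a : R[i] => complex.Re a
  end.

Section Summing.
Variables (R : realType) (k : scalar_kind).
Local Notation K := (scalar_field R k).

Definition rnorm (V : normedModType K) (v : V) : R := real_part `|v|.

Definition sup_norm (T : Type) (V : normedModType K) (D : set T) (f : T -> V) : R :=
  sup [set rnorm (f x) | x in D].

Definition unit_ball (V : normedModType K) : set V := [set v | rnorm v <= 1].

Definition dual_ball (V : normedModType K) : set {linear V -> K^o} :=
  [set phi | continuous phi /\ sup_norm (@unit_ball V) phi <= 1].

Definition weak_norm (q : R) (V : normedModType K) (m : nat) (x : 'I_m -> V) : R :=
  sup [set (\sum_(j < m) rnorm (phi (x j)) `^ q) `^ q^-1
         | phi in @dual_ball V].

Section Multilinear.
Variables (n : nat) (X : 'I_n -> completeNormedModType K).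
Variable Y : completeNormedModType K.
Implicit Type A : (forall i, X i) -> Y.

Definition multilinear A : Prop :=
  forall (i : 'I_n) (x : forall i, X i), linear (fun u : X i => A (dfwith x i u)).

Definition continuous_multilinear A : Prop :=
  multilinear A /\ continuous (A : prod_topology X -> Y).

Definition mnorm A : R := sup_norm [set x | forall i, unit_ball (x i)] A.

Definition summing_const (p : R) (q : 'I_n -> R) A (L : R) : Prop :=
  0 <= L /\
  forall (m : nat) (x : 'I_m -> forall i, X i),
    (\sum_(j < m) rnorm (A (x j)) `^ p) `^ p^-1
      <= L * \prod_(i < n) weak_norm (q i) (fun j => x j i).

Definition absolutely_summing (p : R) (q : 'I_n -> R) A : Prop :=
  continuous_multilinear A /\ exists L : R, summing_const p q A L.

Definition as_norm (p : R) (q : 'I_n -> R) A : R :=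
  inf [set L | summing_const p q A L].

End Multilinear.

End Summing.

Section Join.
Variables (r s : nat) (X : 'I_(r + s) -> Type).

(* The tuple (x_1, ..., x_r, y_1, ..., y_s); the cast only transports along
   [unsplit (split i) = i]. *)
Definition join_tuple (x : forall i : 'I_r, X (lshift s i))
    (y : forall j : 'I_s, X (rshift r j)) (i : 'I_(r + s)) : X i :=
  ecast l (X l) (splitK i)
    match fintype.split i as u return X (unsplit u) with
    | inl a => x a
    | inr b => y b
    end.

Lemma join_tuple_lshift x y (i : 'I_r) : join_tuple x y (lshift s i) = x i.
Proof.
rewrite /join_tuple; move: (splitK (lshift s i)).
rewrite (unsplitK (inl i)) /= => e; by rewrite eq_axiomK.
Qed.

Lemma join_tuple_rshift x y (j : 'I_s) : join_tuple x y (rshift r j) = y j.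
Proof.
rewrite /join_tuple; move: (splitK (rshift r j)).
rewrite (unsplitK (inr j)) /= => e; by rewrite eq_axiomK.
Qed.

End Join.

Definition freeze_head (r s : nat) (X : 'I_(r + s) -> Type) (T : Type)
    (A : (forall i, X i) -> T) (x : forall i : 'I_r, X (lshift s i)) :
    (forall j : 'I_s, X (rshift r j)) -> T :=
  fun y => A (join_tuple x y).

Definition join_exponents (R : realType) (r s : nat) (q : 'I_s -> R) :
    'I_(r + s) -> R :=
  join_tuple (X := fun=> R) (fun=> 1) q.

(* Main.v *)
Require Import Defs.
From HB Require Import structures.
From mathcomp Require Import all_boot all_order all_algebra.
From mathcomp Require Import complex ring lra.
From mathcomp Require Import all_classical all_reals all_analysis.

(** Write the tuples as [(x_j, y_j)] with head [x_j] and tail [y_j].  Fix one head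
    coordinate [i].  For linear maps [T_j] and signs [e], the vectors obtained by
    evaluating [T_j] at [S_e = sum_l e_l x_l(i)] for [e] and for [e] with the
    sign of [j] flipped differ by [+- 2 T_j(x_j(i))]; averaging over [e] gives
    [sum_j |T_j(x_j(i))| <= sum_j |T_j(S_e)|] for some [e].  So the [i]-th
    coordinates of all heads can be replaced by the single vector [S_e], whose norm is
    at most the weak 1-norm of [(x_j(i))_j] by Hahn-Banach.  Once every head coordinate
    is common to all [j], the hypothesis on the frozen mapping applies, with
    constant [C * |A|].

    Hahn-Banach is obtained from Zorn's lemma for sublinear functionals below a given
    one: a minimal sublinear functional [q] is linear, since the sublinear functional
    [x |-> inf_(t >= 0) (q (x + t v) - t q v)] lies below [q], hence equals [q], and
    takes at [- v] a value at most [- q v].  The complex case uses the functional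
    [x |-> f x - i f (i x)]. *)

Set Implicit Arguments.
Unset Strict Implicit.
Unset Printing Implicit Defensive.

Import Order.TTheory GRing.Theory Num.Theory.
Import numFieldNormedType.Exports.

Local Open Scope classical_set_scope.
Local Open Scope ring_scope.

(** * Norms with values in [R], uniformly over the two scalar fields *)

Section RealNorm.
Context {R : realType} {k : scalar_kind}.
Local Notation K := (scalar_field R k).
Implicit Types U V : normedModType K.

Lemma real_partM (a b : K) : a \is Num.real -> real_part (a * b) = real_part a * real_part b.
Proof.
case: k a b => //= a [b1 b2] /complex_realP[c ->] /=.
by rewrite mul0r subr0.
Qed.

Lemma rnorm_ge0 V (v : V) : 0 <= rnorm v.
Proof.
rewrite /rnorm; have : 0 <= `|v| by [].
by case: k V v => //= V v; rewrite lecE /= => /andP[].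
Qed.

Lemma ler_rnorm U V (u : U) (v : V) : (rnorm u <= rnorm v) = (`|u| <= `|v|).
Proof.
rewrite /rnorm; have := normr_real u; have := normr_real v.
case: k U V u v => //= U V u v /complex_realP[a ->] /complex_realP[b ->] /=.
by rewrite lecR.
Qed.

Lemma ler_rnormD V (u v : V) : rnorm (u + v) <= rnorm u + rnorm v.
Proof.
rewrite /rnorm; have := ler_normD u v.
case: k V u v => //= V u v; rewrite lecE => /andP[_] /=.
by case: `|u| => a b; case: `|v|.
Qed.

Lemma rnormZ V (a : K) (v : V) : rnorm (a *: v) = rnorm (a : K^o) * rnorm v.
Proof. by rewrite /rnorm normrZ real_partM. Qed.

Lemma rnorm1 : rnorm (1 : K^o) = 1.
Proof. by rewrite /rnorm normr1; case: k. Qed.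

Lemma rnorm0 V : rnorm (0 : V) = 0.
Proof. by rewrite /rnorm normr0; case: k. Qed.

Lemma rnormN V (v : V) : rnorm (- v) = rnorm v.
Proof. by rewrite /rnorm normrN. Qed.

Lemma rnormMn V (v : V) n : rnorm (v *+ n) = rnorm v *+ n.
Proof. by rewrite /rnorm normrMn; case: k V v => //= V v; rewrite raddfMn. Qed.

Lemma rnorm_sign V (b : bool) (v : V) : rnorm ((-1) ^+ b *: v) = rnorm v.
Proof. by rewrite /rnorm normrZ normrX normrN1 expr1n mul1r. Qed.

Lemma ler_rnorm_sum V (I : Type) (s : seq I) (P : pred I) (F : I -> V) :
  rnorm (\sum_(i <- s | P i) F i) <= \sum_(i <- s | P i) rnorm (F i).
Proof.
apply: (big_ind2 (fun v r => rnorm v <= r)) => // [|u a v b ua vb].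
  by rewrite rnorm0.
exact: le_trans (ler_rnormD u v) (lerD ua vb).
Qed.

(** A real [sup] is a genuine least upper bound only for a bounded set, so continuity is first
    turned into a bound [r] for [phi]. The supremum then controls [phi] on the unit ball, and
    rescaling [v] to norm 1 gives the claim. *)
Lemma dual_ball_le V (phi : {linear V -> K^o}) (v : V) :
  dual_ball phi -> rnorm (phi v) <= rnorm v.
Proof.
case=> phi_cont phi1.
have [r r_real phir] : exists2 r : K, r \is Num.real & forall x, `|phi x| <= r * `|x|.
  have /linear_boundedP[r [r_real phir]] := continuous_linear_bounded 0 (phi_cont 0).
  exists (r + 1); first by rewrite realD.
  by apply: phir; rewrite ltrDl.
have phi_unit u : rnorm u <= 1 -> rnorm (phi u) <= 1.
  move=> u1; apply: le_trans phi1; apply: ub_le_sup; last by exists u.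
  exists (rnorm (r : K^o)) => _ [x x1 <-]; rewrite ler_rnorm (le_trans (phir x))//.
  rewrite (le_trans (ler_wpM2r _ (real_ler_norm r_real)))// ler_piMr//.
  by move: x1; rewrite /unit_ball/= -rnorm1 ler_rnorm normr1.
have [->|v0] := eqVneq v 0; first by rewrite linear0 !rnorm0.
have nv0 : `|v| != 0 by rewrite normr_eq0.
have := phi_unit (`|v|^-1 *: v).
rewrite -rnorm1 linearZ !ler_rnorm !normrZ normfV normr_id mulVf// normr1.
by move=> /(_ (lexx _)); rewrite ler_pdivrMl ?normr_gt0// mulr1.
Qed.

Lemma sum_rnorm_powR1 V m (x : 'I_m -> V) :
  (\sum_(j < m) rnorm (x j) `^ 1) `^ 1^-1 = \sum_(j < m) rnorm (x j).
Proof.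
under eq_bigr do rewrite powRr1 ?rnorm_ge0//.
by rewrite invr1 powRr1// sumr_ge0// => j _; exact: rnorm_ge0.
Qed.

End RealNorm.

(** * Sublinear functionals and the Hahn-Banach theorem over [R] *)

Section HahnBanach.
Context {R : realType}.

Definition sublinear (V : lmodType R) (p : V -> R) :=
  (forall x y, p (x + y) <= p x + p y) /\ (forall t x, 0 < t -> p (t *: x) <= t * p x).

(* The largest sublinear functional below [p] taking at [- v] a value at most [- p v]. *)
Definition slide (V : lmodType R) (p : V -> R) (v x : V) : R :=
  inf [set p (x + t *: v) - t * p v | t in [set t | 0 <= t]].

Variable V : lmodType R.
Implicit Types (p q : V -> R) (u v x y : V) (t : R).

Lemma sublinear0 p : sublinear p -> p 0 = 0.
Proof.
case=> _ pZ; apply/le_anti.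
have := pZ 2 0 (ltr0Sn _ 1); have : 0 < 2^-1 :> R by rewrite invr_gt0 ltr0n.
move=> /(pZ _ 0); rewrite !scaler0 => p0h p02.
by apply/andP; split; lra.
Qed.

Lemma sublinear_ge p x : sublinear p -> - p (- x) <= p x.
Proof.
move=> sub_p; have := sub_p.1 x (- x).
by rewrite subrr sublinear0// -lerBlDr sub0r.
Qed.

Lemma sublinearZ p t x : sublinear p -> 0 < t -> p (t *: x) = t * p x.
Proof.
move=> sub_p t0; apply/le_anti; rewrite sub_p.2//= -ler_pdivlMl//.
rewrite -{1}[x]scale1r -(mulVf (lt0r_neq0 t0)) -scalerA.
by rewrite sub_p.2// invr_gt0.
Qed.

Lemma slide_le p v x t : sublinear p -> 0 <= t -> slide p v x <= p (x + t *: v) - t * p v.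
Proof.
move=> sub_p t0; apply: ge_inf; last by exists t.
(* Lower bound making the infimum genuine: by subadditivity, [a * p v = p ((x + a *: v) - x)] is at
   most [p (x + a *: v) + p (- x)]. The value 0 of [a] is separate because homogeneity is only
   available for positive factors. *)
exists (- p (- x)) => _ [a /= a0 <-].
have [->|a_neq0] := eqVneq a 0.
  by rewrite scale0r addr0 mul0r subr0 sublinear_ge.
have {}a0 : 0 < a by rewrite lt_def a_neq0.
have := sub_p.1 (x + a *: v) (- x).
by rewrite addrAC subrr add0r sublinearZ// => ?; lra.
Qed.

Lemma le_slide p v x b :
  (forall t, 0 <= t -> b <= p (x + t *: v) - t * p v) -> b <= slide p v x.
Proof.
move=> le_b; apply: lb_le_inf; last by move=> _ [t t0 <-]; exact: le_b.
by exists (p (x + 0 *: v) - 0 * p v), 0 => /=.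
Qed.

Lemma slide_le_id p v x : sublinear p -> slide p v x <= p x.
Proof. by move=> /slide_le-/(_ v x 0 (lexx _)); rewrite scale0r addr0 mul0r subr0. Qed.

Lemma slideN p v : sublinear p -> slide p v (- v) <= - p v.
Proof.
move=> sub_p; have := slide_le v (- v) sub_p ler01.
by rewrite scale1r addNr sublinear0// mul1r sub0r.
Qed.

(** Parameters [s] for [x] and [t] for [y] combine into [s + t] for [x + y]; for a positive multiple
    [t *: x] the parameter is scaled by [t] as well. *)
Lemma sublinear_slide p v : sublinear p -> sublinear (slide p v).
Proof.
move=> sub_p; split=> [x y|t x t0].
  rewrite -lerBlDr; apply: le_slide => s s0; rewrite lerBlDr -lerBlDl.
  apply: le_slide => t t0; rewrite lerBlDl.
  have := sub_p.1 (x + s *: v) (y + t *: v); rewrite addrACA -scalerDl.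
  by have := slide_le v (x + y) sub_p (addr_ge0 s0 t0); rewrite mulrDl => ? ?; lra.
rewrite -ler_pdivrMl//; apply: le_slide => a a0; rewrite ler_pdivrMl//.
apply: le_trans (slide_le v _ sub_p (mulr_ge0 (ltW t0) a0)) _.
by rewrite -scalerA -scalerDr sublinearZ// mulrBr mulrA.
Qed.

(** Zorn's lemma for the reversed pointwise order, so that maximal means minimal. A nonempty chain
    is bounded by its pointwise infimum, which is finite because every member is at least
    [- p (- x)] at [x]. *)
Lemma exists_minimal_sublinear p : sublinear p ->
  exists q, [/\ sublinear q, forall x, q x <= p x &
    forall q', sublinear q' -> (forall x, q' x <= q x) -> q' = q].
Proof.
move=> sub_p; pose T := {q : V -> R | sublinear q /\ forall x, q x <= p x}.
pose below (q q' : T) := `[< forall x, sval q' x <= sval q x >].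
have [||||[q [sub_q qp]] q_min] := @Zorn T below.
- by move=> q; apply/asboolP.
- move=> q1 q2 q3 /asboolP q12 /asboolP q23; apply/asboolP => x.
  exact: le_trans (q23 x) (q12 x).
- move=> [q1 ?] [q2 ?] /asboolP q21 /asboolP q12; apply: eq_exist.
  by apply/funext => x; apply/le_anti; rewrite q12 q21.
- move=> A A_tot; have [->|/set0P[q0 Aq0]] := eqVneq A set0.
    by exists (exist _ p (conj sub_p (fun=> lexx _))).
  pose m x := inf [set sval q x | q in A].
  have m_le (q : T) x : A q -> m x <= sval q x.
    move=> Aq; apply: ge_inf; last by exists q.
    exists (- p (- x)) => _ [[q' [sub_q' q'p]] Aq' <-] /=.
    by apply: le_trans (sublinear_ge _ sub_q'); rewrite lerN2.
  have le_m b x : (forall q : T, A q -> b <= sval q x) -> b <= m x.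
    move=> le_b; apply: lb_le_inf => [|_ [q Aq <-]]; last exact: le_b.
    by exists (sval q0 x), q0.
  have sub_m : sublinear m.
    split=> [x y|t x t0].
      rewrite -lerBlDr; apply: (le_m) => q1 Aq1; rewrite lerBlDr -lerBlDl.
      apply: (le_m) => q2 Aq2; rewrite lerBlDl.
      (* The smaller of [q1] and [q2] serves at both arguments; this is where the chain condition
         enters. *)
      have [/asboolP q12|/asboolP q12] := A_tot _ _ Aq1 Aq2.
        rewrite (le_trans (m_le _ _ Aq2))// (le_trans ((svalP q2).1.1 _ _))//.
        by rewrite lerD2r.
      rewrite (le_trans (m_le _ _ Aq1))// (le_trans ((svalP q1).1.1 _ _))//.
      by rewrite lerD2l.
    rewrite -ler_pdivrMl//; apply: (le_m) => q Aq; rewrite ler_pdivrMl//.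
    by rewrite (le_trans (m_le _ _ Aq))// (svalP q).1.2.
  have mp x : m x <= p x by rewrite (le_trans (m_le _ _ Aq0))// (svalP q0).2.
  exists (exist _ m (conj sub_m mp)) => q Aq; apply/asboolP => x; exact: m_le.
exists q; split=> // q' sub_q' q'q.
have q'p x : q' x <= p x by rewrite (le_trans (q'q x)).
by have /(congr1 sval) := q_min (exist _ q' (conj sub_q' q'p)) (asboolT q'q).
Qed.

(** Minimality is sought below [slide p v] rather than [p]: this forces [f (- v) <= - p v], hence
    [f v = p v]. *)
Lemma hahn_banach p v : sublinear p ->
  exists f : {linear V -> R^o}, (forall x, f x <= p x) /\ f v = p v.
Proof.
move=> sub_p; have [q [sub_q q_le q_min]] := exists_minimal_sublinear (sublinear_slide v sub_p).
have qN x : q (- x) = - q x.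
  apply/le_anti/andP; split; last by have := sublinear_ge (- x) sub_q; rewrite opprK.
  rewrite -{1}(q_min _ (sublinear_slide x sub_q))// ?slideN// => y.
  exact: slide_le_id.
have qZ t x : q (t *: x) = t * q x.
  case: (ltrgtP t 0) => [t0|t0|->]; first 1 last.
  - exact: sublinearZ.
  - by rewrite scale0r sublinear0// mul0r.
  by rewrite -[t]opprK scaleNr qN sublinearZ ?oppr_gt0 ?mulNr ?opprK.
have q_lin : linear (q : V -> R^o).
  move=> t x y; apply/le_anti; rewrite -[t *: q x]/(t * q x) -qZ sub_q.1/=.
  (* Since [q] is odd, subadditivity at the opposite vectors is superadditivity. *)
  by have := sub_q.1 (- (t *: x)) (- y); rewrite -opprD !qN -opprD lerN2.
pose f : {linear V -> R^o} := HB.pack (q : V -> R^o) (GRing.isLinear.Build _ _ _ _ _ q_lin).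
exists f; split=> [x|]; first exact: le_trans (q_le x) (slide_le_id _ _ sub_p).
apply/le_anti; rewrite (le_trans (q_le v)) ?slide_le_id//=.
by rewrite -lerN2 -qN (le_trans (q_le _))// slideN.
Qed.

End HahnBanach.

(** * Restriction of scalars; the alias keeps the real scaling apart from the complex one *)

Definition realified (R : realType) (V : lmodType R[i]) : Type := V.

Section Realified.
Local Open Scope complex_scope.
Variables (R : realType) (V : lmodType R[i]).

HB.instance Definition _ := GRing.Zmodule.copy (realified V) V.

Let real_scale (t : R) (v : realified V) : realified V := t%:C *: (v : V).

Let real_scaleA a b v : real_scale a (real_scale b v) = real_scale (a * b) v.
Proof. by rewrite /real_scale scalerA rmorphM. Qed.

Let real_scale1 : left_id 1 real_scale.
Proof. by move=> v; rewrite /real_scale rmorph1 scale1r. Qed.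

Let real_scaleDr : right_distributive real_scale +%R.
Proof. by move=> a u v; rewrite /real_scale -scalerDr. Qed.

Let real_scaleDl v : {morph real_scale^~ v : a b / a + b}.
Proof. by move=> a b; rewrite /real_scale rmorphD scalerDl. Qed.

HB.instance Definition _ := GRing.Zmodule_isLmodule.Build R (realified V)
  real_scaleA real_scale1 real_scaleDr real_scaleDl.

End Realified.

(** * Functionals of norm at most 1 attaining the norm of a given vector *)

Section NormingFunctional.
Context {R : realType}.

Lemma sublinear_normr (V : normedModType R) : sublinear (fun v : V => `|v|).
Proof. by split=> [x y|t x t0]; rewrite ?ler_normD// normrZ gtr0_norm. Qed.

Lemma norming_real (V : normedModType R) (v : V) :
  exists2 f : {linear V -> R^o}, forall x, `|f x| <= `|x| & `|f v| = `|v|.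
Proof.
have [f [f_le fv]] := hahn_banach v (sublinear_normr V).
exists f => [x|]; last by rewrite fv normr_id.
by rewrite ler_norml f_le andbT lerNl -linearN -normrN f_le.
Qed.

Local Open Scope complex_scope.

Lemma norming_complex (V : normedModType R[i]) (v : V) :
  exists2 f : {linear V -> R[i]^o}, forall x, `|f x| <= `|x| & `|f v| = `|v|.
Proof.
pose N (x : realified V) : R := complex.Re `|x : V|.
have NC (x : V) : `|x| = (N x)%:C by rewrite RRe_real ?normr_real.
have sub_N : sublinear N.
  split=> [x y|t x t0].
    by have := ler_normD (x : V) y; rewrite !NC -rmorphD lecR.
  have := normrZ t%:C (x : V); rewrite !NC gtr0_norm ?ltcR// -rmorphM.
  by case=> ->.
have [f [f_le fv]] := hahn_banach (v : realified V) sub_N.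
pose g (x : V) : R[i]^o := f x +i* - f ('i *: x).
have g_lin : linear g.
  have fD (x y : V) : f (x + y) = f x + f y by exact: linearD.
  (* [f] is linear on [realified V], where scaling by [t] unfolds to scaling by [t%:C] in [V]. *)
  have fZ (t : R) (x : V) : f (t%:C *: x) = t * f x by exact: linearZ.
  have f_scale a b (x : V) : f ((a +i* b) *: x) = a * f x + b * f ('i *: x).
    by rewrite [a +i* b]complexE scalerDl fD (mulrC 'i) -scalerA !fZ.
  have iab a b : 'i * (a +i* b) = - b +i* a :> R[i] by simpc.
  move=> [a b] x y; rewrite /g.
  have -> : f ((a +i* b) *: x + y) = a * f x + b * f ('i *: x) + f y.
    by rewrite fD f_scale.
  have -> : f ('i *: ((a +i* b) *: x + y)) = - b * f x + a * f ('i *: x) + f ('i *: y).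
    by rewrite scalerDr scalerA iab fD f_scale.
  transitivity ((a +i* b) * (f x +i* - f ('i *: x)) + (f y +i* - f ('i *: y))); last by [].
  by simpc; congr (_ +i* _); ring.
pose G : {linear V -> R[i]^o} := HB.pack g (GRing.isLinear.Build _ _ _ _ _ g_lin).
have Re_g x : complex.Re (g x) = f x by [].
have g_le x : `|G x| <= `|x|.
  (* Rotating [x] by a unit scalar [c] makes [G x] real, hence equal to [f (c *: x)]. *)
  have [->|gx0] := eqVneq (G x) 0; first by rewrite normr0.
  pose c := `|G x| / G x.
  have c1 : `|c| = 1 by rewrite /c normrM normr_id normfV divff ?normr_eq0.
  have : c * G x = `|G x| by rewrite /c divfK.
  rewrite -[c * _]/(c *: G x) -linearZ /= => gcx.
  rewrite -gcx -[leRHS]mul1r -c1 -normrZ NC.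
  rewrite -[g (c *: x)]RRe_real ?gcx ?normr_real//.
  by rewrite -gcx lecR Re_g f_le.
exists G => //.
(* Conversely, the modulus of [g v] is at least its real part [f v], which is the norm of [v]. *)
apply/le_anti; rewrite g_le NC -fv -Re_g /= (le_trans _ (normc_ge_Re _))//.
by rewrite lecR ler_norm.
Qed.

Lemma exists_norming (k : scalar_kind) (V : normedModType (scalar_field R k)) (v : V) :
  exists2 phi : {linear V -> (scalar_field R k)^o}, dual_ball phi & rnorm (phi v) = rnorm v.
Proof.
have [phi phi_le phi_v] : exists2 phi : {linear V -> (scalar_field R k)^o},
    (forall x, `|phi x| <= `|x|) & `|phi v| = `|v|.
  by case: k V v => V v; [exact: norming_real|exact: norming_complex].
exists phi; last by rewrite /rnorm phi_v.
split.
  apply: bounded_linear_continuous; apply/linear_boundedP; exists 1; split=> // r r1 x.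
  by rewrite (le_trans (phi_le x))// ler_peMl// ltW.
apply: ge_sup.
  by exists (rnorm (phi 0)), 0 => //=; rewrite /unit_ball/= rnorm0 ler01.
by move=> _ [x x1 <-]; rewrite (le_trans _ x1)// ler_rnorm.
Qed.

End NormingFunctional.

(** * Weak norms and averaging over signs *)

Section Summing.
Context {R : realType} {k : scalar_kind}.
Local Notation K := (scalar_field R k).

Lemma sup_ge0 (E : set R) : (forall x, E x -> 0 <= x) -> 0 <= sup E.
Proof.
move=> E_ge0; have [supE|/sup_out->//] := pselect (has_sup E).
have [x Ex] := supE.1; apply: le_trans (E_ge0 x Ex) _.
exact: ub_le_sup supE.2 _ Ex.
Qed.

Lemma weak_norm_ge0 (V : normedModType K) q m (x : 'I_m -> V) : 0 <= weak_norm q x.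
Proof. by apply: sup_ge0 => _ [phi _ <-]; exact: powR_ge0. Qed.

Definition signed_sum (V : lmodType K) m (e : {ffun 'I_m -> bool}) (x : 'I_m -> V) : V :=
  \sum_(l < m) (-1) ^+ e l *: x l.

(** A functional norming the signed sum is a competitor in the supremum defining the weak norm, and
    the signs vanish under absolute values. The sum of the norms of the [x j] bounds that
    supremum. *)
Lemma rnorm_signed_sum (V : normedModType K) m (e : {ffun 'I_m -> bool}) (x : 'I_m -> V) :
  rnorm (signed_sum e x) <= weak_norm 1 x.
Proof.
have [phi phi_ball <-] := exists_norming (signed_sum e x).
apply: (@le_trans _ _ (\sum_(j < m) rnorm (phi (x j)))).
  rewrite linear_sum (le_trans (ler_rnorm_sum _ _ _))//.
  by apply: ler_sum => j _; rewrite linearZ rnorm_sign.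
apply: ub_le_sup; last by exists phi; rewrite ?sum_rnorm_powR1.
exists (\sum_(j < m) rnorm (x j)) => _ [psi psi_ball <-].
by rewrite sum_rnorm_powR1 ler_sum// => j _; exact: dual_ball_le.
Qed.

Lemma linear_signed_sum (V W : lmodType K) (T : {linear V -> W}) m
    (e : {ffun 'I_m -> bool}) (x : 'I_m -> V) :
  T (signed_sum e x) = signed_sum e (T \o x).
Proof. by rewrite linear_sum; apply: eq_bigr => j _; rewrite linearZ. Qed.

Definition flip_sign m (j : 'I_m) (e : {ffun 'I_m -> bool}) : {ffun 'I_m -> bool} :=
  [ffun l => e l (+) (l == j)].

Lemma flip_signK m (j : 'I_m) : involutive (flip_sign j).
Proof. by move=> e; apply/ffunP => l; rewrite !ffunE addbK. Qed.

Lemma signed_sumB_flip (V : lmodType K) m (j : 'I_m) (e : {ffun 'I_m -> bool}) (x : 'I_m -> V) :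
  signed_sum e x - signed_sum (flip_sign j e) x = (-1) ^+ e j *: (x j + x j).
Proof.
rewrite -sumrB (bigD1 j)//= big1 => [|l /negPf lj].
  by rewrite addr0 ffunE eqxx signr_addb expr1 mulrN1 scaleNr opprK scalerDr.
by rewrite ffunE lj addbF subrr.
Qed.

Lemma rnorm_le_average_signs (V : normedModType K) m (j : 'I_m) (x : 'I_m -> V) :
  #|{ffun 'I_m -> bool}|%:R * rnorm (x j) <= \sum_e rnorm (signed_sum e x).
Proof.
(* After doubling, one of the two copies of the sum is reindexed by flipping the sign of [j]. The
   terms for [e] and its flip then dominate the norm of their difference, which is that of
   [x j + x j]. *)
rewrite -(ler_pM2l (ltr0Sn R 1)) mulrCA [leRHS]mulr_natl [leRHS]mulr2n.
rewrite [X in _ <= _ + X](reindex_inj (inv_inj (flip_signK j))) -big_split/= mulr_natl.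
rewrite -sumr_const ler_sum// => e _.
rewrite mulr_natl -rnormMn mulr2n -(rnorm_sign (e j)) -signed_sumB_flip.
by rewrite -(rnormN (signed_sum (flip_sign j e) x)) ler_rnormD.
Qed.

Lemma exists_signs (V W : normedModType K) m (T : 'I_m -> {linear V -> W}) (x : 'I_m -> V) :
  exists e, \sum_(j < m) rnorm (T j (x j)) <= \sum_(j < m) rnorm (T j (signed_sum e x)).
Proof.
pose F e := \sum_(j < m) rnorm (T j (signed_sum e x)).
pose e0 : {ffun 'I_m -> bool} := [ffun=> false].
(* A maximizing choice of signs does at least as well as the average. *)
pose e := [arg max_(e > e0) F e]%O; exists e.
have F_le e' : F e' <= F e by rewrite /e; case: arg_maxP => // ? _; apply.
rewrite -(@ler_pM2l _ #|{ffun 'I_m -> bool}|%:R); last first.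
  by rewrite ltr0n; apply/card_gt0P; exists e0.
have F_sum : \sum_e' F e' <= #|{ffun 'I_m -> bool}|%:R * F e.
  by rewrite mulr_natl -sumr_const ler_sum.
rewrite mulr_sumr; apply: le_trans F_sum.
rewrite exchange_big ler_sum// => j _.
apply: le_trans (rnorm_le_average_signs j (T j \o x)) _.
by apply: ler_sum => e' _; rewrite linear_signed_sum.
Qed.

Section SummingConstants.
Variables (n : nat) (X : 'I_n -> completeNormedModType K) (Y : completeNormedModType K).
Variables (q : 'I_n -> R) (B : (forall i, X i) -> Y).

Lemma summing_const1E L : summing_const 1 q B L <-> 0 <= L /\
  forall (m : nat) (x : 'I_m -> forall i, X i),
    \sum_(j < m) rnorm (B (x j)) <= L * \prod_(i < n) weak_norm (q i) (fun j => x j i).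
Proof.
by split=> -[L0 BL]; split=> // m x; have := BL m x; rewrite sum_rnorm_powR1.
Qed.

(** The infimum of the summing constants is itself admissible: divide by the product [w] and pass to
    the infimum. If [w] is 0, any one constant already makes the left side at most 0. *)
Lemma as_norm_bound m (x : 'I_m -> forall i, X i) : absolutely_summing 1 q B ->
  \sum_(j < m) rnorm (B (x j)) <= as_norm 1 q B * \prod_(i < n) weak_norm (q i) (fun j => x j i).
Proof.
case=> _ [L0 L0_const]; set w := \prod_(i < n) _.
have : 0 <= w by apply: prodr_ge0 => i _; exact: weak_norm_ge0.
rewrite le_eqVlt => /orP[/eqP w0|w_gt0].
  have /summing_const1E[_ /(_ m x)] := L0_const.
  by rewrite -/w -w0 !mulr0.
rewrite -ler_pdivrMr//; apply: lb_le_inf; first by exists L0.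
by move=> L /summing_const1E[_ /(_ m x)]; rewrite ler_pdivrMr.
Qed.

End SummingConstants.

(** * Replacing the heads of all tuples by a common one *)

Lemma exists_signs_multilinear n (X : 'I_n -> completeNormedModType K)
    (Y : completeNormedModType K) (A : (forall i, X i) -> Y) m
    (z : 'I_m -> forall i, X i) (i : 'I_n) : multilinear A ->
  exists e, \sum_(j < m) rnorm (A (z j)) <=
    \sum_(j < m) rnorm (A (dfwith (z j) i (signed_sum e (fun l => z l i)))).
Proof.
move=> A_lin.
pose T j : {linear X i -> Y} :=
  HB.pack (fun u : X i => A (dfwith (z j) i u)) (GRing.isLinear.Build _ _ _ _ _ (A_lin i (z j))).
have [e Te] := exists_signs T (fun l => z l i).
exists e; apply: le_trans Te; rewrite ler_sum// => j _ /=.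
suff -> : dfwith (z j) i (z j i) = z j by [].
apply: functional_extensionality_dep => l.
by case: dfwithP.
Qed.

(** Head coordinates are made common one at a time, each time by the sign choice with all other
    coordinates held fixed. Coordinates not yet treated are still the original ones, so each new
    vector is bounded by the weak norm of the original sequence. *)
Lemma exists_common_head r s (X : 'I_(r + s) -> completeNormedModType K)
    (Y : completeNormedModType K) (A : (forall i, X i) -> Y) m
    (x : 'I_m -> forall i, X i) : multilinear A ->
  exists v : forall i : 'I_r, X (lshift s i),
    (forall i, rnorm (v i) <= weak_norm 1 (fun j => x j (lshift s i))) /\
    \sum_(j < m) rnorm (A (x j)) <=
      \sum_(j < m) rnorm (freeze_head A v (fun l => x j (rshift r l))).
Proof.
move=> A_lin.
(* The coordinates [i < d] of the heads have been replaced by common vectors. *)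
pose z (d : nat) (w : forall i : 'I_r, X (lshift s i)) (j : 'I_m) : forall i, X i := join_tuple
  (fun i : 'I_r => if (i < d)%N then w i else x j (lshift s i))
  (fun l => x j (rshift r l)).
have z_head c : (c <= r)%N -> exists v : forall i : 'I_r, X (lshift s i),
    (forall i, rnorm (v i) <= weak_norm 1 (fun j => x j (lshift s i))) /\
    \sum_(j < m) rnorm (A (x j)) <= \sum_(j < m) rnorm (A (z c v j)).
  elim: c => [_|c IHc c_lt].
    exists (fun i => 0); split=> [i|]; first by rewrite rnorm0 weak_norm_ge0.
    rewrite ler_sum// => j _.
    suff -> : z 0%N (fun i => 0) j = x j by [].
    apply: functional_extensionality_dep => i; rewrite /z.
    by case: (split_ordP i) => l ->; rewrite ?join_tuple_lshift ?join_tuple_rshift.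
  have [v [v_le v_sum]] := IHc (ltnW c_lt).
  pose i0 := Ordinal c_lt.
  have [e z_sum] := exists_signs_multilinear (z c v) (lshift s i0) A_lin.
  pose u := signed_sum e (fun l => z c v l (lshift s i0)).
  exists (dfwith v i0 u); split=> [i|].
    case: dfwithP => //.
    apply: le_trans (rnorm_signed_sum _ _) _.
    suff -> : (fun l => z c v l (lshift s i0)) = (fun j => x j (lshift s i0)) by [].
    (* Stage [c] has replaced only indices strictly below [c], so coordinate [c] is untouched. *)
    by apply/funext => j; rewrite /z join_tuple_lshift ltnn.
  apply: (le_trans v_sum); apply: (le_trans z_sum); rewrite ler_sum// => j _.
  rewrite -/u.
  suff -> : dfwith (z c v j) (lshift s i0) u = z c.+1 (dfwith v i0 u) j by [].
  apply: functional_extensionality_dep => i.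
  case: (split_ordP i) => l ->.
    rewrite [RHS]join_tuple_lshift ltnS leq_eqVlt.
    have [->|l_neq] := eqVneq l i0.
      by rewrite eqxx !dfwithin.
    rewrite dfwithout; last by rewrite (inj_eq (@lshift_inj _ _)) eq_sym.
    rewrite dfwithout 1?eq_sym//.
    rewrite [LHS]join_tuple_lshift; case: eqP => [cl|//].
    by case/eqP: l_neq; exact/val_inj.
  rewrite dfwithout ?eq_lrshift//.
  by rewrite [LHS]join_tuple_rshift [RHS]join_tuple_rshift.
have [v [v_le v_sum]] := z_head r (leqnn r).
exists v; split=> //; apply: le_trans v_sum _; rewrite ler_sum// => j _.
suff -> : z r v j = join_tuple v (fun l => x j (rshift r l)) by [].
by congr join_tuple; apply: functional_extensionality_dep => i; rewrite ltn_ord.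
Qed.

End Summing.

Theorem theorem3 (R : realType) (k : scalar_kind) (r s : nat)
    (hr : (0 < r)%N) (hs : (0 < s)%N)
    (X : 'I_(r + s) -> completeNormedModType (scalar_field R k))
    (Y : completeNormedModType (scalar_field R k))
    (q : 'I_s -> R) (hq : forall j, 0 < q j)
    (A : (forall i, X i) -> Y) (hA : continuous_multilinear A)
    (hC : exists C : R, 0 < C /\
      forall x : (forall i : 'I_r, X (lshift s i)),
        absolutely_summing 1 q (freeze_head A x) /\
        as_norm 1 q (freeze_head A x)
          <= C * mnorm A * \prod_(i < r) rnorm (x i)) :
  absolutely_summing 1 (join_exponents q) A.
Proof.
split=> //; have [C [C0 as_le]] := hC.
have CA_ge0 : 0 <= C * mnorm A.
  by rewrite mulr_ge0 ?(ltW C0)//; apply: sup_ge0 => _ [x _ <-]; exact: rnorm_ge0.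
exists (C * mnorm A); apply/summing_const1E; split=> // m x.
have [v [v_le /le_trans->//]] := exists_common_head x hA.1.
have [v_as v_as_le] := as_le v.
(* With the common head [v], the weak norms of the tails are the last [s] factors. The first [r]
   factors have exponent 1 and dominate the norms of the [v i] in the hypothesis on [as_norm]. *)
apply: le_trans (as_norm_bound _ v_as) _; rewrite big_split_ord /=.
under [X in _ <= _ * (X * _)]eq_bigr do rewrite /join_exponents join_tuple_lshift.
under [X in _ <= _ * (_ * X)]eq_bigr do rewrite /join_exponents join_tuple_rshift.
rewrite mulrA ler_wpM2r ?prodr_ge0// => [i _|]; first exact: weak_norm_ge0.
apply: le_trans v_as_le _; rewrite ler_wpM2l// ler_prod// => i _.
by rewrite rnorm_ge0 v_le.
Qed.
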